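(* For every integer $\ell\ge 3$, the maximum of $R(T)$ over all proper binary trees $T$ with $\ell$ leaves equals $2(\ell-\lfloor\log_2\ell\rfloor-1)+z(\ell)$.
   Context: All trees are rooted; for a vertex $v$ of $T$, $T(v)$ is the subtree induced by $v$ and its descendants, and a leaf is a vertex with no children. The rank of $v$ is $R_T(v)=\min d(u,v)$ over leaves $u$ of $T(v)$, and the security is $R(T)=\sum_{v\in V(T)}R_T(v)$. A proper binary tree is an unordered rooted tree in which every non-leaf vertex has exactly two children. $z(\ell)$ denotes the number of digits equal to $0$ in the binary expansion of $\ell$ (which has $\lfloor\log_2\ell\rfloor+1$ digits); equivalently, if $\ell$ is a sum of $k$ distinct powers of two, then $z(\ell)=\lfloor\log_2\ell\rfloor+1-k$. *)

(* Defs.v *)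
From HB Require Import structures.
From mathcomp Require Import all_boot.

Set Implicit Arguments.
Unset Strict Implicit.
Unset Printing Implicit Defensive.

(* Finite rooted trees presented by their parent function.  The root has no
   parent, but [parent] is total: the value [root] at [root] is a convention,
   and [children] discards it.  As every vertex reaches the root by iterating
   [parent], there is no other cycle.  No order is put on siblings. *)
Record rootedTree := RootedTree {
  vertex :> finType;
  root : vertex;
  parent : vertex -> vertex;
  parent_root : parent root = root;
  connect_root : forall v : vertex, fconnect parent v root }.

Section RootedTree.
Variable T : rootedTree.
Implicit Types u v w : T.

Definition children v : {set T} :=
  [set u | (u != root T) && (parent u == v)].

Definition is_leaf v : bool := children v == set0.

Definition leaves : {set T} := [set v | is_leaf v].

(* The vertex set of T(v); it contains v. *)
Definition subtree v : {set T} := [set u | fconnect (@parent T) u v].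

Definition adj u v : bool := (u \in children v) || (v \in children u).

Definition walk (n : nat) u v : bool :=
  [exists p : n.-tuple T, path adj u p && (last u p == v)].

Lemma adj_sym u v : adj u v = adj v u.
Proof. by rewrite /adj orbC. Qed.

Lemma connect_adj_root v : connect adj v (root T).
Proof.
have sub : subrel (frel (@parent T)) (connect adj).
  move=> x y /eqP <-; have [->|xr] := eqVneq x (root T).
    by rewrite parent_root connect0.
  by apply: connect1; rewrite /adj inE xr eqxx.
exact: (connect_sub sub (connect_root v)).
Qed.

Lemma walk_exists u v : exists n, walk n u v.
Proof.
have /connectP[p pp ->] : connect adj u v.
  apply: (connect_trans (connect_adj_root u)).
  by rewrite (sym_connect_sym adj_sym) connect_adj_root.
by exists (size p); apply/existsP; exists (in_tuple p); rewrite pp eqxx.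
Qed.

Definition dist u v : nat := ex_minn (walk_exists u v).

Lemma subtree_leaf_exists v :
  exists n : nat, [exists u in subtree v, is_leaf u && (dist u v == n)].
Proof.
pose depth u := findex (@parent T) u (root T).
have vv : v \in subtree v by rewrite inE connect0.
pose u := [arg max_(w > v in subtree v) depth w].
have [uv umax] : u \in subtree v /\ forall w, w \in subtree v -> depth w <= depth u.
  by rewrite /u; case: arg_maxnP.
exists (dist u v); apply/existsP; exists u; rewrite uv eqxx andbT /=.
apply/negPn/negP => /set0Pn[w]; rewrite inE => /andP[wr /eqP wu].
have : w \in subtree v.
  by move: uv; rewrite !inE -wu; apply/connect_trans/fconnect1.
move/umax; rewrite /depth (fconnect_findex (connect_root w)) 1?eq_sym // wu.
by rewrite ltnn.
Qed.

(* A vertex of T(v) has all its children in T(v), so the leaves of T(v) are the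
   leaves of T lying in it. *)
Definition rank v : nat := ex_minn (subtree_leaf_exists v).

Definition security : nat := \sum_(v : T) rank v.

Definition proper_binary : Prop :=
  forall v, ~~ is_leaf v -> #|children v| = 2.

End RootedTree.

(* [trunc_log 2 l] is the floor of log_2 l, and [odd (l %/ 2 ^ i)] is the
   binary digit of l of weight 2 ^ i. *)
Definition zero_digits (l : nat) : nat :=
  #|[set i : 'I_(trunc_log 2 l).+1 | ~~ odd (l %/ 2 ^ i)]|.

(* Main.v *)
From mathcomp Require Import all_boot.
From mathcomp Require Import zify.
Require Import Defs.

(** The right-hand side equals [\sum_(r <= log_2 l) (l %/ 2 ^ r - 1)] (Legendre).
    Upper bound: by induction up the tree, the ranks in a subtree with [m] leaves
    add up to at most [\sum_r (m %/ 2 ^ r - 1)].  A vertex of rank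
    [k > 0] has at least [2 ^ (k - 1)] leaves below each of its two children; write
    [a] and [b] for these numbers of leaves, so that for every [r < k]
    both [a %/ 2 ^ r] and [b %/ 2 ^ r] are positive, and merging the two sums saves
    a unit in each of these [k] terms.
    Lower bound: in the heap-ordered tree (children of [i] are [2 i + 1] and
    [2 i + 2]) a leaf nearest to [i] is reached by always going right, so [i] has
    rank greater than [r] when [(i + 2) * 2 ^ r <= l]; this holds for
    [l %/ 2 ^ r - 1] vertices. *)

Set Implicit Arguments.
Unset Strict Implicit.
Unset Printing Implicit Defensive.

(** * Depth, distance and rank in a rooted tree *)

Section Depth.
Variable T : rootedTree.
Implicit Types u v w c : T.

Definition depth u : nat := findex (@parent T) u (root T).

Lemma depth_root : depth (root T) = 0.
Proof. by rewrite /depth findex0. Qed.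

Lemma depth_parent u : u != root T -> depth u = (depth (parent u)).+1.
Proof. by move=> ur; rewrite /depth (fconnect_findex (connect_root u)) // eq_sym. Qed.

Lemma depth_iter k u : depth (iter k (@parent T) u) = depth u - k.
Proof.
elim: k => [|k IH] /=; first by rewrite subn0.
have [wr|wr] := eqVneq (iter k (@parent T) u) (root T).
  by move: IH; rewrite wr parent_root depth_root; lia.
by move: IH; rewrite (depth_parent wr); lia.
Qed.

Lemma depth_children v c : c \in children v -> depth c = (depth v).+1.
Proof. by rewrite inE => /andP[cr /eqP <-]; apply: depth_parent. Qed.

Lemma subtree_refl v : v \in subtree v.
Proof. by rewrite inE connect0. Qed.

Lemma subtree_root : subtree (root T) = setT.
Proof. by apply/setP=> u; rewrite !inE connect_root. Qed.

Lemma subtree_iterP u v :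
  u \in subtree v -> exists2 k, depth u = k + depth v & iter k (@parent T) u = v.
Proof.
rewrite inE => /iter_findex <-; elim: (findex _ u v) => [|n [k ek ik]].
  by exists 0.
rewrite iterS; set w := iter n _ u in ek ik *.
have [wr|wr] := eqVneq w (root T).
  (* [parent] fixes the root, so an iteration there is idle and is not counted in [k]. *)
  by exists k; rewrite wr parent_root -wr.
by exists k.+1; rewrite ?iterS ?ik // ek (depth_parent wr) addnS.
Qed.

Lemma subtree_same_depth u v w :
  u \in subtree v -> u \in subtree w -> depth v = depth w -> v = w.
Proof.
move=> /subtree_iterP[k ek kv] /subtree_iterP[j ej jw] e.
by rewrite -kv -jw; have -> : k = j by lia.
Qed.

Lemma adj_depth u v : adj u v -> depth u <= (depth v).+1.
Proof. by rewrite /adj => /orP[] /depth_children; lia. Qed.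

Lemma walk_depth n u v : walk n u v -> depth u <= n + depth v.
Proof.
case/existsP=> p /andP[+ /eqP <-]; rewrite -{2}(size_tuple p).
elim: (tval p) u => [|w q IH] u //= /andP[/adj_depth uw /IH]; lia.
Qed.

Lemma walk_iter_parent k u : k <= depth u -> walk k u (iter k (@parent T) u).
Proof.
elim: k u => [|k IH] u ku; first by apply/existsP; exists [tuple]; rewrite /= eqxx.
have ur : u != root T by apply: contraTneq ku => ->; rewrite depth_root.
have /existsP[p /andP[pp pl]] : walk k (parent u) (iter k (@parent T) (parent u)).
  by apply: IH; move: ku; rewrite (depth_parent ur).
apply/existsP; exists [tuple of parent u :: p]; rewrite iterSr /= pp pl !andbT.
by rewrite /adj !inE ur eqxx.
Qed.

(** An edge changes the depth by at most one, and climbing from [u] to [v] attains this bound. Ranks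
    are computed from depths from here on. *)
Lemma dist_depth u v : u \in subtree v -> depth u = dist u v + depth v.
Proof.
case/subtree_iterP=> k ek iv; rewrite /dist; case: ex_minnP => n nw nmin.
have kn : n <= k by apply: nmin; rewrite -iv; apply: walk_iter_parent; lia.
by have := walk_depth nw; lia.
Qed.

Lemma rank_leaf_le u v :
  u \in subtree v -> is_leaf u -> rank v + depth v <= depth u.
Proof.
move=> uv ul; rewrite (dist_depth uv) leq_add2r /rank.
by case: ex_minnP => n _; apply; apply/existsP; exists u; rewrite uv ul eqxx.
Qed.

Lemma rank_attained v :
  exists u, [/\ u \in subtree v, is_leaf u & depth u = rank v + depth v].
Proof.
rewrite /rank; case: ex_minnP => n /existsP[u /and3P[uv ul /eqP e]] _.
by exists u; split=> //; rewrite (dist_depth uv) e.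
Qed.

Lemma children_subtree v c : c \in children v -> {subset subtree c <= subtree v}.
Proof.
rewrite inE => /andP[_ /eqP <-] u; rewrite !inE => uc.
exact: connect_trans uc (fconnect1 _ _).
Qed.

Lemma rank_children v c : c \in children v -> rank v <= (rank c).+1.
Proof.
move=> vc; have [u [uc ul e]] := rank_attained c.
have := rank_leaf_le (children_subtree vc uc) ul.
by rewrite e (depth_children vc); lia.
Qed.

Lemma rank_leaf v : is_leaf v -> rank v = 0.
Proof. by move=> vl; have := rank_leaf_le (subtree_refl v) vl; lia. Qed.

(** On the climb to [v] from a nearest leaf, [g] starts at 0 and gains at most one per edge. A lower
    bound on ranks thus needs only a local check. *)
Lemma rank_ge (g : T -> nat) :
    (forall u, is_leaf u -> g u = 0) ->
    (forall u, u != root T -> g (parent u) <= (g u).+1) ->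
  forall v, g v <= rank v.
Proof.
move=> g0 gp v; have [u [uv /g0 gu0 e]] := rank_attained v.
have [k ek kv] := subtree_iterP uv.
(* Keeping the null term [g u] gives an inequality that can be proved for arbitrary [u] by induction
   on [k]. *)
have -> : rank v = k + g u by lia.
have {e ek}: k <= depth u by lia.
rewrite -kv; move: {v uv kv} u {gu0}.
elim: k => [|k IH] u //= ku.
have ur : u != root T by apply: contraTneq ku => ->; rewrite depth_root.
rewrite -iterS iterSr (leq_trans (IH _ _)) //.
  by move: ku; rewrite (depth_parent ur).
by rewrite addSnnS leq_add2l gp.
Qed.

Lemma subtree_children v :
  subtree v = v |: \bigcup_(c in children v) subtree c.
Proof.
apply/setP=> u; rewrite in_setU1; apply/idP/orP.
  move=> uv; have [k ek] := subtree_iterP uv.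
  case: k ek => [|k] ek e; first by left; apply/eqP.
  right; apply/bigcupP; exists (iter k (@parent T) u).
    rewrite inE -iterS e eqxx andbT; apply/eqP => wr.
    by have := depth_iter k u; rewrite wr depth_root ek; lia.
  by rewrite inE fconnect_iter.
case=> [/eqP ->|/bigcupP[c cv uc]]; first exact: subtree_refl.
exact: children_subtree cv _ uc.
Qed.

Lemma subtree_leaf v : is_leaf v -> subtree v = [set v].
Proof. by move=> /eqP v0; rewrite subtree_children v0 big_set0 setU0. Qed.

Lemma sum_subtree_two v a b (h : T -> nat) :
    a != b -> children v = [set a; b] ->
  \sum_(u in subtree v) h u =
  h v + (\sum_(u in subtree a) h u + \sum_(u in subtree b) h u).
Proof.
move=> ab vab.
have va : a \in children v by rewrite vab !inE eqxx.
have vb : b \in children v by rewrite vab !inE eqxx orbT.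
have notin c : c \in children v -> v \notin subtree c.
  move=> /depth_children dc; apply/negP => /subtree_iterP[k]; lia.
rewrite subtree_children vab bigcup_setU !big_set1.
rewrite big_setU1 /=; last by rewrite inE negb_or !notin.
congr (_ + _); rewrite -bigU /=; first by apply: eq_bigl => u; rewrite !inE.
(* A common vertex would have two distinct ancestors, [a] and [b], at the same depth. *)
rewrite disjoint_subset; apply/subsetP => u ua; rewrite inE; apply/negP => ub.
have eab := subtree_same_depth ua ub; rewrite eab ?eqxx // in ab.
by rewrite (depth_children va) (depth_children vb).
Qed.

Lemma card_leaves : #|leaves T| = \sum_(v : T) is_leaf v.
Proof.
rewrite /leaves -sum1dep_card big_mkcond.
by apply: eq_bigr => v _; case: is_leaf.
Qed.

End Depth.

(** * Sums of floors and the upper bound *)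

Lemma sum_ord_ltn m k : \sum_(i < m) (i < k) = minn m k.
Proof.
elim: m => [|m IH]; first by rewrite big_ord0; lia.
by rewrite big_ord_recr /= IH; case: leqP; lia.
Qed.

Lemma sum_ord_geq m k : \sum_(i < m) (k <= i) = m - k.
Proof.
elim: m => [|m IH]; first by rewrite big_ord0; lia.
by rewrite big_ord_recr /= IH; case: leqP; lia.
Qed.

(** For positive [m < 2 ^ N] this is [\sum_(r <= log_2 m) (m %/ 2 ^ r - 1)]:
    truncated subtraction kills the other terms. *)
Definition halvings (N m : nat) : nat := \sum_(r < N) (m %/ 2 ^ r - 1).

Lemma halvings_add N a b k :
    k <= N -> 2 ^ k <= (minn a b).*2 ->
  k + (halvings N a + halvings N b) <= halvings N (a + b).
Proof.
move=> kN kab.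
have -> : k = \sum_(r < N) (r < k).
  by rewrite sum_ord_ltn; apply/esym/minn_idPr.
rewrite -!big_split /=; apply: leq_sum => r _.
have r0 : 0 < 2 ^ r by rewrite expn_gt0.
have dD : a %/ 2 ^ r + b %/ 2 ^ r <= (a + b) %/ 2 ^ r by rewrite divnD ?leq_addr.
have pos : r < k -> 0 < a %/ 2 ^ r /\ 0 < b %/ 2 ^ r.
  move=> rk; have : 2 ^ r.+1 <= 2 ^ k by rewrite leq_exp2l.
  by rewrite !divn_gt0 // expnS; lia.
move: (a %/ _) (b %/ _) ((a + b) %/ _) dD pos => x y z.
(* For [r < k] the saved unit pays for [1 + (x - 1) + (y - 1) = x + y - 1]; for other [r] a zero
   quotient is harmless, as [0 - 1] is 0. *)
by case: (r < k) => xyz; [case=> // | move=> _]; lia.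
Qed.

Lemma security_le (T : rootedTree) (N : nat) :
    proper_binary T -> #|leaves T| < 2 ^ N ->
  security T <= halvings N #|leaves T|.
Proof.
move=> bT lN; pose lv (v : T) := \sum_(u in subtree v) is_leaf u.
have lvr : lv (root T) = #|leaves T|.
  by rewrite /lv subtree_root card_leaves; apply: eq_bigl => u; rewrite inE.
have lv_le v : lv v <= #|leaves T|.
  by rewrite card_leaves [leqRHS](bigID (mem (subtree v))) leq_addr.
(* The first conjunct feeds the second: it gives the hypothesis of [halvings_add] at the parent, and
   with [lN] it keeps every rank below the fixed [N]. *)
have main v : 2 ^ rank v <= lv v /\
    \sum_(u in subtree v) rank u <= halvings N (lv v).
  have [n] := ubnP #|subtree v|; elim: n v => // n IH v; rewrite ltnS => vn.
  have [vl|vl] := boolP (is_leaf v).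
    by rewrite /lv subtree_leaf // !big_set1 rank_leaf // vl; split.
  have [a [b [ab vab]]] : exists a b, a != b /\ children v = [set a; b].
    by apply/cards2P/eqP/bT.
  have va : a \in children v by rewrite vab !inE eqxx.
  have vb : b \in children v by rewrite vab !inE eqxx orbT.
  have size (h : T -> nat) := sum_subtree_two h ab vab.
  have vE := size (fun=> 1); rewrite !sum1_card in vE.
  have [|ra sa] := IH a; first by lia.
  have [|rb sb] := IH b; first by lia.
  have lvE : lv v = lv a + lv b by rewrite /lv size (negbTE vl).
  have rv : 2 ^ rank v <= (minn (lv a) (lv b)).*2.
    have := rank_children va; have := rank_children vb.
    rewrite -(leq_exp2l (m := 2)) // -(leq_exp2l (m := 2) (rank v)) // !expnS.
    by lia.
  have rlv : 2 ^ rank v <= lv v by lia.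
  split=> //; rewrite size lvE.
  apply: leq_trans (halvings_add _ rv); first by rewrite leq_add2l leq_add.
  apply: ltnW; rewrite -(ltn_exp2l (m := 2)) //.
  exact: leq_ltn_trans (leq_trans rlv (lv_le v)) lN.
have := (main (root T)).2; rewrite lvr subtree_root /security.
by rewrite (eq_bigl predT) // => u; rewrite inE.
Qed.

(** The left side does not depend on [n]: with [m = l %/ 2 ^ n], the next step changes it by
    [2 * (m %/ 2) + odd m - m = 0]. *)
Lemma sum_divn_exp2 l n :
  \sum_(r < n) l %/ 2 ^ r + 2 * (l %/ 2 ^ n) + \sum_(r < n) odd (l %/ 2 ^ r) = 2 * l.
Proof.
elim: n => [|n IH]; first by rewrite !big_ord0 divn1; lia.
rewrite !big_ord_recr /= expnSr divnMA divn2.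
move: (l %/ 2 ^ n) IH (odd_double_half (l %/ 2 ^ n)) => m.
by move: (\sum_(r < n) _) (\sum_(r < n) _) => s t; lia.
Qed.

Lemma halvings_zero_digits l :
    0 < l ->
  halvings (trunc_log 2 l).+1 l =
  2 * (l - trunc_log 2 l - 1) + zero_digits l.
Proof.
move=> l0; set n := trunc_log 2 l.
have /andP[nl ln] : 2 ^ n <= l < 2 ^ n.+1 by apply: trunc_log_bounds.
have nltl : n < l by apply: leq_trans nl; apply: ltn_expl.
have := sum_divn_exp2 l n.+1; rewrite (divn_small ln).
(* All these quotients are positive, so no subtraction in [halvings] is truncated and exactly [n.+1]
   units are restored. *)
have -> : \sum_(r < n.+1) l %/ 2 ^ r = halvings n.+1 l + n.+1.
  rewrite /halvings -[X in _ + X]card_ord -sum1_card -big_split /=.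
  apply: eq_bigr => r _; rewrite subnK // divn_gt0 ?expn_gt0 //.
  by apply: leq_trans nl; rewrite leq_exp2l // -ltnS.
have : \sum_(r < n.+1) odd (l %/ 2 ^ r) + zero_digits l = n.+1.
  rewrite /zero_digits -sum1dep_card [X in _ + X]big_mkcond -big_split /=.
  rewrite -[RHS]card_ord -sum1_card; apply: eq_bigr => r _.
  by case: odd.
lia.
Qed.

(** * Heap-ordered trees and the lower bound *)

Section Heap.
Variable n : nat.

(** Here [n] is the number of internal vertices, those of index below [n]. As [0.-1] is 0, the root
    is its own parent. *)
Definition heap_parent (i : 'I_(2 * n).+1) : 'I_(2 * n).+1 := inord (i.-1./2).

Lemma val_heap_parent i : heap_parent i = i.-1./2 :> nat.
Proof. by rewrite inordK //; have := ltn_ord i; lia. Qed.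

Lemma heap_parent0 : heap_parent ord0 = ord0.
Proof. by apply: val_inj; rewrite /= val_heap_parent. Qed.

Lemma heap_connect i : fconnect heap_parent i ord0.
Proof.
have [m] := ubnP (i : nat); elim: m i => // m IH i im.
have [->|i0] := eqVneq i ord0; first exact: connect0.
apply: connect_trans (fconnect1 _ _) (IH _ _); rewrite val_heap_parent.
by move: i0; rewrite -val_eqE /=; lia.
Qed.

Definition heap : rootedTree := RootedTree heap_parent0 heap_connect.

Lemma heap_children (i j : heap) :
  (j \in children i) = (j == (2 * i).+1 :> nat) || (j == (2 * i).+2 :> nat).
Proof. rewrite inE -!val_eqE /= val_heap_parent; lia. Qed.

Lemma heap_is_leaf (i : heap) : is_leaf i = (n <= i).
Proof.
apply/eqP/idP => [e|ni].
  rewrite leqNgt; apply/negP => lt_in.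
  have := heap_children i (inord (2 * i).+1).
  by rewrite e inE inordK ?eqxx //; lia.
apply/setP=> j; rewrite heap_children inE; have := ltn_ord j; lia.
Qed.

Lemma heap_proper_binary : proper_binary heap.
Proof.
move=> i; rewrite heap_is_leaf -ltnNge => lt_in.
have lt1 : (2 * i).+1 < (2 * n).+1 by lia.
have lt2 : (2 * i).+2 < (2 * n).+1 by lia.
have -> : children i = [set (Ordinal lt1 : heap); (Ordinal lt2 : heap)].
  by apply/setP=> j; rewrite heap_children !inE -!val_eqE.
by rewrite cards2 -val_eqE /=; lia.
Qed.

Lemma heap_leaves : #|leaves heap| = n.+1.
Proof.
rewrite card_leaves (eq_bigr (fun i : heap => nat_of_bool (n <= i))) => [|i _].
  by rewrite sum_ord_geq; lia.
by rewrite heap_is_leaf.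
Qed.

(** Double counting of the pairs [(i, r)] with [(i + 2) * 2 ^ r <= n + 1]: by [r] they give
    [halvings], by [i] a lower bound [g i] for the rank. *)
Lemma heap_security (N : nat) : halvings N n.+1 <= security heap.
Proof.
pose g (i : heap) := \sum_(r < N) ((i.+2 * 2 ^ r) <= n.+1).
have -> : halvings N n.+1 = \sum_i g i.
  rewrite exchange_big /=; apply: eq_bigr => r _.
  have q_le : n.+1 %/ 2 ^ r <= n.+1 by apply: leq_div.
  rewrite (eq_bigr (fun i : heap => nat_of_bool (i < n.+1 %/ 2 ^ r - 1))) => [|i _].
    by rewrite sum_ord_ltn; lia.
  by rewrite -leq_divRL ?expn_gt0 // ltn_subRL.
apply: leq_sum => i _; apply: rank_ge => {i} [i|i i0].
  rewrite heap_is_leaf => ni; apply: big1 => r _.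
  have : 0 < 2 ^ r by rewrite expn_gt0.
  by case: leqP => // /[swap]; nia.
rewrite {}/g; case: N => [|m]; first by rewrite !big_ord0.
(* The term [r = 0] of the parent [p] costs at most one; its term [r + 1] implies the term [r] of
   [i], since [i + 2 <= 2 * (p + 2)]. *)
rewrite big_ord_recl [X in _ <= X.+1]big_ord_recr /=.
rewrite -[leqRHS]add1n leq_add ?leq_b1 //.
apply: leq_trans (leq_addr _ _); apply: leq_sum => r _.
rewrite /bump /= expnS val_heap_parent.
have le_ip : i.+2 * 2 ^ r <= i.-1./2.+2 * (2 * 2 ^ r).
  by rewrite mulnA leq_mul2r; lia.
case le_pn: (_ * (2 * _) <= _) => //.
by rewrite (leq_trans le_ip le_pn).
Qed.
End Heap.

Theorem theorem2p9 (l : nat) (hl : 3 <= l) :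
  let M := 2 * (l - trunc_log 2 l - 1) + zero_digits l in
  (exists T : rootedTree,
     [/\ proper_binary T, #|leaves T| = l & security T = M]) /\
  (forall T : rootedTree,
     proper_binary T -> #|leaves T| = l -> security T <= M).
Proof.
move=> M; have l0 : 0 < l by lia.
rewrite /M -halvings_zero_digits //; set N := (trunc_log 2 l).+1.
have upper (T : rootedTree) :
    proper_binary T -> #|leaves T| = l -> security T <= halvings N l.
  move=> bT lT; rewrite -lT; apply: security_le => //.
  by rewrite lT trunc_log_ltn.
split=> //; exists (heap l.-1).
have [bH lH] := (@heap_proper_binary l.-1, heap_leaves l.-1).
rewrite prednK // in lH; split=> //; apply/eqP; rewrite eqn_leq upper //=.
by have := heap_security l.-1 N; rewrite prednK.
Qed.
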